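(* Consider the L-SVRG iteration (defined in the context) with stepsize $\eta>0$, probability $p\in(0,1]$ and sampling (or sampling with replacement) $S$. Suppose: (1) there are $L_f>0$, $\mu_f\ge 0$, $\mu_\psi\ge 0$ with $\mu:=\mu_f+\mu_\psi>0$ such that $\frac{L_f}{2}\|x\|^2-f(x)$, $f(x)-\frac{\mu_f}{2}\|x\|^2$ and $\psi(x)-\frac{\mu_\psi}{2}\|x\|^2$ are convex; (2) there is a constant $\mathcal{L}_1>0$ such that for all $x\in\mathbb{R}^d$ $$\mathbb{E}\left[\left\|\tfrac1n(\mathbf{G}(x)-\mathbf{G}(x^* ))\theta_S\mathbf{I}_Se\right\|^2\right]\le 2\mathcal{L}_1\left(f(x)-f(x^* )-\langle\nabla f(x^* ),x-x^*\rangle\right).$$ If $\eta\le\frac{1}{6\mathcal{L}_1}$, then for every $k\ge 0$ $$\mathbb{E}_k\left[\|x^{k+1}-x^*\|^2+\mathcal{D}_S^{k+1}\right]\le\left(1-\frac{\eta\mu}{1+\eta\mu_\psi}\right)\|x^k-x^*\|^2+\left(1-\frac p2\right)\mathbb{E}_k[\mathcal{D}_S^k].$$ Moreover, if $\eta=\frac{1}{6\mathcal{L}_1}$, then with $\Psi_S^k:=\|x^k-x^*\|^2+\mathcal{D}_S^k$ one has, for $\epsilon\in(0,1)$, $\mathbb{E}[\Psi_S^k]\le\epsilon\,\mathbb{E}[\Psi_S^0]$ as long as $k\ge O\left(\left(\frac1p+\frac{\mathcal{L}_1}{\mu}\right)\log\frac1\epsilon\right)$, i.e. there is an absolute constant $c>0$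 such that this holds whenever $k\ge c\left(\frac1p+\frac{\mathcal{L}_1}{\mu}\right)\log\frac1\epsilon$.
   Context: Problem: minimize $P(x)=f(x)+\psi(x)$ over $x\in\mathbb{R}^d$, where $f=\frac1n\sum_{i=1}^nf_i$, each $f_i:\mathbb{R}^d\to\mathbb{R}$ is differentiable, and $\psi:\mathbb{R}^d\to\mathbb{R}\cup\{+\infty\}$ is proper, closed and convex. $P$ has at least one global minimizer; $x^*$ denotes one. The individual $f_i$ need not be convex. Sampling: $[n]=\{1,\dots,n\}$ and $e\in\mathbb{R}^n$ is the all-ones vector. $S$ is one of the following. (a) A proper sampling: a random subset of $[n]$ with $\mathbb{P}[i\in S]>0$ for all $i$, together with real weights $\theta_C^i$ ($i\in[n]$, $C\subseteq[n]$). (b) A sampling with replacement: $S$ consists of $\tau$ independent copies of an index drawn from a distribution on $[n]$ with probabilities $\tilde p_i>0$ (repetitions counted), with weights $\theta_S^i=1/(\tau\tilde p_i)$. $\theta_S$ is the $n\times n$ diagonal matrix with diagonal entries $\theta_S^i$, and $\mathbf{I}_S$ is the diagonal matrix whose $i$-th diagonal entry is the number of copies of $i$ in $S$. It is assumed that $\mathbb{E}[\theta_S\mathbf{I}_S]e=e$ (automatic in case (b)). $\mathbf{G}(x)=[\nabla f_1(x),\dots,\nabla f_n(x)]\in\mathbb{R}^{d\times n}$, so $\frac1n\mathbf{G}(x)\theta_S\mathbf{I}_Se=\frac1n\sum_{i\in S}\theta_S^i\nabla f_i(x)$ with multiplicities. Proximal operator: $\mathrm{prox}_\eta(x)=\arg\min_y\{\frac{1}{2\eta}\|x-y\|^2+\psi(y)\}$.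 L-SVRG: $x^0=w^0\in\mathbb{R}^d$. For $k=0,1,2,\dots$: draw $S_k$ as a fresh independent copy of $S$; set $g^k=\frac1n(\mathbf{G}(x^k)-\mathbf{G}(w^k))\theta_{S_k}\mathbf{I}_{S_k}e+\frac1n\mathbf{G}(w^k)e$; set $x^{k+1}=\mathrm{prox}_\eta(x^k-\eta g^k)$; set $w^{k+1}=x^k$ with probability $p$ and $w^{k+1}=w^k$ with probability $1-p$ (by an independent coin flip). $\mathbb{E}_k[\cdot]$ is the expectation conditional on $x^k$ and $w^k$. The quantity $$\mathcal{D}_S^k=\frac{1}{1+\eta\mu_\psi}\cdot\frac{4\eta^2}{p}\cdot\left\|\tfrac1n(\mathbf{G}(w^k)-\mathbf{G}(x^* ))\theta_S\mathbf{I}_Se\right\|^2$$ is random also through $S$, which here denotes a copy of the sampling independent of the algorithm's iterates; expectations are taken over it as well. *)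

(* Defs.v *)
From mathcomp Require Import all_boot all_order all_algebra.
From mathcomp Require Import all_classical all_reals all_analysis.

Set Implicit Arguments.
Unset Strict Implicit.
Unset Printing Implicit Defensive.

Import Order.TTheory GRing.Theory Num.Theory.
Import numFieldNormedType.Exports.

Local Open Scope classical_set_scope.
Local Open Scope ring_scope.

(* Euclidean structure of R^d. The norm `|x| that MathComp-Analysis puts on
   matrices is the sup norm; it is used here only through the topology. *)
Definition dotp (R : realType) (d : nat) (u v : 'cV[R]_d) : R :=
  (u^T *m v) 0 0.

Definition sqnorm (R : realType) (d : nat) (u : 'cV[R]_d) : R := dotp u u.

Definition grad (R : realType) (d : nat) (f : 'cV[R]_d -> R) (x : 'cV[R]_d) :
    'cV[R]_d :=
  \col_j 'D_(delta_mx j 0) f x.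

Definition convex_on_space (R : realType) (d : nat) (f : 'cV[R]_d -> R) : Prop :=
  convex_function [set: convex_lmodType 'cV[R]_d] f.

Section ExtendedValued.
Context (R : realType) (d : nat).
Implicit Types psi : 'cV[R]_d -> \bar R.

Definition econvex psi : Prop :=
  forall (x y : 'cV[R]_d) (t : R), 0 < t < 1 ->
    (psi (t *: x + (1 - t) *: y)%R <= t%:E * psi x + (1 - t)%:E * psi y)%E.

Definition proper_fun psi : Prop :=
  (forall x, psi x != -oo%E) /\ (exists x, (psi x < +oo)%E).

Definition closed_fun psi : Prop :=
  closed [set u : 'cV[R]_d * R | (psi u.1 <= u.2%:E)%E].

Definition is_prox (eta : R) psi (x y : 'cV[R]_d) : Prop :=
  forall z,
    (((2 * eta)^-1 * sqnorm (x - y))%:E + psi y <=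
     ((2 * eta)^-1 * sqnorm (x - z))%:E + psi z)%E.

(* The default value 0 is irrelevant: the argmin exists and is unique when psi
   is proper, closed and convex and eta > 0. *)
Definition prox (eta : R) psi (x : 'cV[R]_d) : 'cV[R]_d :=
  xget 0 [set y | is_prox eta psi x y].

End ExtendedValued.

(* [Subset q theta]: a random subset of [n], equal to C with probability q C,
   with weights theta C i.
   [Replacement tau pt]: tau independent indices with distribution pt, kept as
   a tuple so that repetitions are counted. *)
Variant sampling (R : realType) (n : nat) :=
| Subset of ({set 'I_n} -> R) & ({set 'I_n} -> 'I_n -> R)
| Replacement (tau : nat) of ('I_n -> R).

Section Sampling.
Context (R : realType) (n : nat).
Implicit Types S : sampling R n.

Definition outcome S : finType :=
  match S with
  | Subset _ _ => {set 'I_n}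
  | Replacement tau _ => tau.-tuple 'I_n
  end.

Definition sampling_law S : outcome S -> R :=
  match S return outcome S -> R with
  | Subset q _ => q
  | Replacement tau pt => fun s : tau.-tuple 'I_n => \prod_(i <- s) pt i
  end.

Definition weight S : outcome S -> 'I_n -> R :=
  match S return outcome S -> 'I_n -> R with
  | Subset _ theta => theta
  | Replacement tau pt => fun _ i => (tau%:R * pt i)^-1
  end.

Definition copies S : outcome S -> 'I_n -> nat :=
  match S return outcome S -> 'I_n -> nat with
  | Subset _ _ => fun (C : {set 'I_n}) i => (i \in C) : nat
  | Replacement tau _ => fun (s : tau.-tuple 'I_n) i => count_mem i s
  end.

Definition valid_sampling S : Prop :=
  match S with
  | Subset q _ =>
      [/\ forall C, 0 <= q C,
          \sum_C q C = 1
        & forall i, 0 < \sum_(C : {set 'I_n} | i \in C) q C]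
  | Replacement tau pt =>
      [/\ (0 < tau)%N, forall i, 0 < pt i & \sum_i pt i = 1]
  end.

Definition theta_mx S (s : outcome S) : 'M[R]_n :=
  diag_mx (\row_i weight s i).

Definition I_mx S (s : outcome S) : 'M[R]_n :=
  diag_mx (\row_i (copies s i)%:R).

Definition ones : 'cV[R]_n := const_mx 1.

Definition unbiased S : Prop :=
  (\sum_(s : outcome S) sampling_law s *: (theta_mx s *m I_mx s)) *m ones = ones.

Definition sample_mean S (F : outcome S -> R) : R :=
  \sum_(s : outcome S) sampling_law s * F s.

End Sampling.
Arguments ones {R n}.

Section Algorithm.
Context (R : realType) (d n : nat).
Variables (f : 'I_n -> 'cV[R]_d -> R) (psi : 'cV[R]_d -> \bar R).
Variables (S : sampling R n).
Implicit Types x w xs : 'cV[R]_d.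

Definition favg x : R := n%:R^-1 * \sum_i f i x.

Definition is_minimizer xs : Prop :=
  forall x, ((favg xs)%:E + psi xs <= (favg x)%:E + psi x)%E.

Definition grad_mx x : 'M[R]_(d, n) := \matrix_(j, i) grad (f i) x j 0.

Definition sampled_diff (s : outcome S) x w : 'cV[R]_d :=
  n%:R^-1 *: ((grad_mx x - grad_mx w) *m theta_mx s *m I_mx s *m ones).

Definition svrg_grad (s : outcome S) x w : 'cV[R]_d :=
  sampled_diff s x w + n%:R^-1 *: (grad_mx w *m ones).

(* The pair (x^k, w^k) as a function of the realized draws s and coins b. *)
Fixpoint lsvrg (eta : R) (x0 : 'cV[R]_d) (s : nat -> outcome S)
    (b : nat -> bool) (k : nat) : 'cV[R]_d * 'cV[R]_d :=
  match k with
  | 0%N => (x0, x0)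
  | k'.+1 =>
      let: (x, w) := lsvrg eta x0 s b k' in
      (prox eta psi (x - eta *: svrg_grad (s k') x w), if b k' then x else w)
  end.

Definition Dquant (eta p mu_psi : R) xs (s : outcome S) w : R :=
  (1 + eta * mu_psi)^-1 * (4 * eta ^+ 2 / p) * sqnorm (sampled_diff s w xs).

End Algorithm.

Section Randomness.
Context (disp : measure_display) (T : measurableType disp) (R : realType).
Variable P : probability T R.

Definition has_law (V : finType) (X : T -> V) (q : V -> R) : Prop :=
  forall v, measurable (X @^-1` [set v]) /\ P (X @^-1` [set v]) = (q v)%:E.

Definition events_of (V : finType) (X : T -> V) : set_system T :=
  preimage_set_system setT X [set: set V].

Definition mutually_independent (I : eqType) (F : I -> set_system T) : Prop :=
  forall (J : seq I) (E : I -> set T), uniq J ->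
    (forall i, i \in J -> F i (E i)) ->
    P (\big[setI/setT]_(i <- J) E i) = (\prod_(i <- J) P (E i))%E.

(* Conditional expectation of Y given a random element Z with finitely many
   values, as a random variable: on the event {Z = z} it is
   E[Y 1_{Z = z}] / P(Z = z). The pair (x^k, w^k) has finitely many values
   because x^0 is deterministic and every draw and coin is finitely valued. *)
Definition cond_expectation (V : Type) (Z : T -> V) (Y : T -> R) (t : T) :
    \bar R :=
  let A := [set u | Z u = Z t] in
  ((fine (P A))^-1%:E * 'E_P[Y \* \1_A])%E.

Variables (n : nat) (S : sampling R n) (p : R).

(* [copy] is the independent copy of S through which D_S^k is random. *)
Definition lsvrg_randomness (draw : nat -> T -> outcome S)
    (coin : nat -> T -> bool) (copy : T -> outcome S) : Prop :=
  [/\ forall k, has_law (draw k) (@sampling_law R n S),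
      forall k, has_law (coin k) (fun b => if b then p else 1 - p),
      has_law copy (@sampling_law R n S)
    & mutually_independent (fun i : nat + nat + unit =>
        match i with
        | inl (inl k) => events_of (draw k)
        | inl (inr k) => events_of (coin k)
        | inr _ => events_of copy
        end)].

End Randomness.

(* Main.v *)
Require Import Defs.
From mathcomp Require Import all_boot all_order all_algebra.
From mathcomp Require Import all_classical all_reals all_analysis.
From mathcomp Require Import ring lra.

(** The Lyapunov function sqnorm (x^k - xs) + D^k contracts in mean because the
    variance of the loopless SVRG estimator g^k is controlled by two quantities
    that both vanish at the minimizer.

    Optimality of xs gives the subgradient inequality
    psi z >= psi xs - <grad f xs, z - xs> + mu_psi / 2 * |z - xs|^2
    ([minimizer_variational]). It provides an affine minorant of psi, hence the
    existence of proximal points ([prox_exists]), and, added to the same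
    inequality for the proximal subproblem, the contraction
    (1 + eta mu_psi) |prox a - xs|^2 <= |a - (xs - eta grad f xs)|^2
    ([prox_contraction]). Take a = x - eta g and average over the draw. The
    estimator is unbiased, so the cross term is bounded by strong convexity of
    f, which produces - eta mu_f |x - xs|^2 - 2 eta B(x) with B the Bregman
    divergence of f at xs. Its second moment is at most 2 V(x) + 2 V(w), where
    V(y) is the mean of the squared sampled gradient difference between y and xs
    ([svrg_grad_second_moment]), and V(x) <= 2 L1 B(x).

    The term V(w) is what D^k measures: D^{k+1} keeps a proportion 1 - p of D^k
    and receives V(x) with probability p. The weight 4 eta^2 / p turns the
    contribution 2 eta^2 V(w) into p / 2 times D^k, and the total coefficient of
    B(x) is - 2 eta (1 - 6 eta L1) <= 0 ([one_step]).

    On the probabilistic side, the iterates at time k are functions of the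
    history of the first k draws and coins, which takes finitely many values. By
    mutual independence, the history and the independent copy of the sampling
    have an explicit product law ([history_copy_has_law]), so that all
    expectations and conditional expectations are finite sums. Averaging
    [one_step] over the history with an arbitrary nonnegative weight
    ([weighted_step]) gives the conditional bound when the weight is the
    indicator of the conditioning event, and the bound on expectations when it
    is 1. With eta = 1 / (6 L1), the contraction factor is at most
    1 - 1 / A for A = 6 (1 / p + L1 / mu), and (1 - 1 / A)^k <= exp (- k / A);
    hence the constant c = 6. *)

Set Implicit Arguments.
Unset Strict Implicit.
Unset Printing Implicit Defensive.

Import Order.TTheory GRing.Theory Num.Theory.
Import numFieldNormedType.Exports.

Local Open Scope classical_set_scope.
Local Open Scope ring_scope.

(** * Euclidean algebra *)

Section DotProduct.
Context (R : realType) (d : nat).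
Implicit Types (u v w : 'cV[R]_d) (a t : R).

Lemma dotpE u v : dotp u v = \sum_j u j 0 * v j 0.
Proof. by rewrite /dotp mxE; apply: eq_bigr => j _; rewrite mxE. Qed.

Lemma dotpC u v : dotp u v = dotp v u.
Proof. by rewrite !dotpE; apply: eq_bigr => j _; rewrite mulrC. Qed.

Lemma dotpDl u v w : dotp (u + v) w = dotp u w + dotp v w.
Proof. by rewrite /dotp linearD mulmxDl mxE. Qed.

Lemma dotpZl a u w : dotp (a *: u) w = a * dotp u w.
Proof. by rewrite /dotp linearZ -scalemxAl mxE. Qed.

Lemma dotpNl u w : dotp (- u) w = - dotp u w.
Proof. by rewrite -scaleN1r dotpZl mulN1r. Qed.

Lemma dotpDr u v w : dotp w (u + v) = dotp w u + dotp w v.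
Proof. by rewrite dotpC dotpDl !(dotpC w). Qed.

Lemma dotpZr a u w : dotp w (a *: u) = a * dotp w u.
Proof. by rewrite dotpC dotpZl dotpC. Qed.

Lemma dotpNr u w : dotp w (- u) = - dotp w u.
Proof. by rewrite dotpC dotpNl dotpC. Qed.

Lemma dotp_suml (I : finType) (F : I -> 'cV[R]_d) w :
  dotp (\sum_i F i) w = \sum_i dotp (F i) w.
Proof. by rewrite /dotp linear_sum mulmx_suml summxE. Qed.

Lemma dotp_sumr (I : finType) (F : I -> 'cV[R]_d) w :
  dotp w (\sum_i F i) = \sum_i dotp w (F i).
Proof. by rewrite dotpC dotp_suml; apply: eq_bigr => i _; rewrite dotpC. Qed.

Lemma sqnorm_ge0 u : 0 <= sqnorm u.
Proof. by rewrite /sqnorm dotpE sumr_ge0 // => j _; rewrite -expr2 sqr_ge0. Qed.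

Definition dotpL := (dotpDl, dotpDr, dotpNl, dotpNr, dotpZl, dotpZr).

Lemma sqnormD u v : sqnorm (u + v) = sqnorm u + 2 * dotp u v + sqnorm v.
Proof. by rewrite /sqnorm !dotpL (dotpC v u); ring. Qed.

Lemma sqnormZ a u : sqnorm (a *: u) = a ^+ 2 * sqnorm u.
Proof. by rewrite /sqnorm !dotpL mulrA expr2. Qed.

Lemma sqnormN u : sqnorm (- u) = sqnorm u.
Proof. by rewrite /sqnorm !dotpL opprK. Qed.

Lemma sqnormB u v : sqnorm (u - v) = sqnorm u - 2 * dotp u v + sqnorm v.
Proof. by rewrite sqnormD sqnormN dotpNr mulrN. Qed.

Lemma dotp_young a u v : 0 < a ->
  2 * dotp u v <= a * sqnorm u + a^-1 * sqnorm v.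
Proof.
move=> a0; have := sqnorm_ge0 (a *: u - v).
rewrite sqnormB sqnormZ dotpZl => h.
rewrite -(ler_pM2l a0) mulrDr mulVKf ?gt_eqF //.
nra.
Qed.

Lemma continuous_sqnorm : continuous (@sqnorm R d).
Proof.
have -> : @sqnorm R d = fun u => \sum_j u j 0 * u j 0.
  by apply/funext => u; rewrite /sqnorm dotpE.
apply: continuous_big => [|j _ u]; first exact: add_continuous.
have cj : v j 0 @[v --> u] --> u j 0 by exact: coord_continuous.
exact: (cvgM cj cj).
Qed.

Lemma sqr_coord_le_sqnorm u j : u j 0 ^+ 2 <= sqnorm u.
Proof.
rewrite /sqnorm dotpE (bigD1 j) //= -expr2 lerDl.
by rewrite sumr_ge0 // => i _; rewrite -expr2 sqr_ge0.
Qed.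

End DotProduct.

(** * Differentiability and first-order conditions *)

Section Gradient.
Context (R : realType) (d : nat).
Implicit Types (f g : 'cV[R]_d -> R) (x v G : 'cV[R]_d).

Lemma derive_grad f x v : differentiable f x -> 'D_v f x = dotp (grad f x) v.
Proof.
move=> df; rewrite deriveE // dotpE.
have {1}-> : v = \sum_j v j 0 *: delta_mx j 0.
  rewrite [LHS]matrix_sum_delta; apply: eq_bigr => j _.
  by rewrite big_ord1.
rewrite linear_sum; apply: eq_bigr => j _.
by rewrite linearZ mxE deriveE //= mulrC.
Qed.

(** [G] represents the one-sided directional derivatives of [g] at [x]. This is
    the only form of differentiability that the first-order conditions use. *)
Definition directional_gradient g x G := forall v (e : R), 0 < e ->
  \forall t \near 0^'+, `|g (x + t *: v) - g x - t * dotp G v| <= t * e.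

Lemma differentiable_directional_gradient f x :
  differentiable f x -> directional_gradient f x (grad f x).
Proof.
move=> df v e e0; rewrite -derive_grad //.
have /cvg_dnbhs_at_right/cvgrPdist_le/(_ _ e0) : derivable f x v.
  exact: diff_derivable.
apply: filterS2 (nbhs_right_gt 0) => t t0 /=.
rewrite -/(derive f x v) distrC.
rewrite -(ler_pM2l t0) -[X in X * `|_|](gtr0_norm t0) -normrM.
rewrite mulrBr [t * (t^-1 *: _)]mulrA mulfV ?gt_eqF // mul1r [_ + x]addrC.
by [].
Qed.

Lemma directional_gradient_sqdist (c : R) x y :
  directional_gradient (fun u => c * sqnorm (x - u)) y ((2 * c) *: (y - x)).
Proof.
move=> v e e0; pose a := `|c * sqnorm v|.
have a1 : 0 < a + 1 by rewrite ltr_wpDl ?normr_ge0.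
near=> t; have t0 : 0 < t by near: t; exact: nbhs_right_gt.
have -> : c * sqnorm (x - (y + t *: v)) - c * sqnorm (x - y)
    - t * dotp ((2 * c) *: (y - x)) v = t * (t * (c * sqnorm v)).
  rewrite opprD addrA [sqnorm (x - y - _)]sqnormB dotpZr dotpZl sqnormZ.
  by rewrite -(opprB x y) dotpNl; ring.
rewrite normrM (gtr0_norm t0) ler_pM2l // normrM (gtr0_norm t0).
have : t <= e / (a + 1) by near: t; apply: nbhs_right_ltW; rewrite divr_gt0.
rewrite ler_pdivlMr // => h.
by apply: le_trans h; rewrite ler_pM2l // lerDl.
Unshelve. all: end_near. Qed.

Lemma right_witness (M : R) (A : set R) :
  0 < M -> (\forall t \near 0^'+, A t) ->
  exists t, [/\ 0 < t, t < M & A t].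
Proof.
move=> M0 nA; apply: (@filter_ex _ 0^'+).
near=> t; split; near: t => //; [exact: nbhs_right_gt|exact: nbhs_right_lt].
Unshelve. all: end_near. Qed.

End Gradient.

Section StrongConvexity.
Context (R : realType) (d : nat).
Implicit Types (g : 'cV[R]_d -> R) (psi : 'cV[R]_d -> \bar R).
Implicit Types (x y z G : 'cV[R]_d).

Lemma sqnorm_convex_comb (t : R) y z :
  sqnorm (t *: z + (1 - t) *: y) =
  t * sqnorm z + (1 - t) * sqnorm y - t * (1 - t) * sqnorm (z - y).
Proof.
by rewrite (sqnormB z y) sqnormD !sqnormZ dotpZl dotpZr; ring.
Qed.

(** First-order lower bound for a differentiable strongly convex function. *)
Lemma strongly_convex_lower g (mu : R) y z G :
  convex_on_space (fun u => g u - mu / 2 * sqnorm u) ->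
  directional_gradient g y G ->
  g y + dotp G (z - y) + mu / 2 * sqnorm (z - y) <= g z.
Proof.
move=> cg dg; apply/ler_addgt0Pr => e e0.
set N := mu / 2 * sqnorm (z - y).
have N1 : 0 < `|N| + 1 by rewrite ltr_wpDl.
have e20 : 0 < e / 2 by rewrite divr_gt0.
have M0 : 0 < Num.min 1 (e / 2 / (`|N| + 1)) by rewrite lt_min ltr01 divr_gt0.
(* Compare the values at y and at y + t (z - y). The step t is small enough for
   the first-order error t * (e / 2) and for t * N <= e / 2. *)
have [t [t0]] := right_witness M0 (dg (z - y) _ e20).
rewrite lt_min ler_norml => /andP[t1]; rewrite ltr_pdivlMr // => tN /andP[h _].
have t01 : 0 <= t <= 1 by rewrite !ltW.
have := cg (Itv01 (ltW t0) (ltW t1)) z y.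
rewrite !inE => /(_ I I) => ct.
have {ct} : g (t *: z + (1 - t) *: y) - mu / 2 * sqnorm (t *: z + (1 - t) *: y)
    <= t * (g z - mu / 2 * sqnorm z) + (1 - t) * (g y - mu / 2 * sqnorm y).
  exact: ct.
rewrite sqnorm_convex_comb.
have -> : t *: z + (1 - t) *: y = y + t *: (z - y).
  by rewrite scalerBl scale1r scalerBr addrCA.
have -> : mu / 2 * (t * sqnorm z + (1 - t) * sqnorm y
      - t * (1 - t) * sqnorm (z - y)) =
    mu / 2 * (t * sqnorm z + (1 - t) * sqnorm y) - t * (1 - t) * N.
  by rewrite /N; ring.
move: h; set gg := g (y + _); set g0 := g y; set D := dotp _ _ => h h2.
have tNN : t * N <= t * (`|N| + 1).
  by rewrite ler_pM2l // (le_trans (ler_norm _)) // lerDl.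
have tN2 : t * (t * N) <= t * (e / 2) by rewrite ler_pM2l //; lra.
rewrite -(ler_pM2l t0); lra.
Qed.

Lemma econvex_strong psi (mu : R) y z (r s t : R) :
  econvex (fun u => (psi u - (mu / 2 * sqnorm u)%:E)%E) ->
  psi y = r%:E -> psi z = s%:E -> 0 < t < 1 ->
  (psi (t *: z + (1 - t) *: y)%R
     <= (t * s + (1 - t) * r - mu / 2 * (t * (1 - t) * sqnorm (z - y)))%:E)%E.
Proof.
move=> cpsi yr zs t01; have := cpsi z y t t01.
rewrite yr zs -!EFinB -!EFinM -EFinD leeBlDr // => /le_trans; apply.
rewrite -EFinD lee_fin sqnorm_convex_comb; lra.
Qed.

Lemma minimizer_fin psi g y : proper_fun psi ->
  (forall u, ((g y)%:E + psi y <= (g u)%:E + psi u)%E) -> psi y \is a fin_num.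
Proof.
move=> [pN [u pu]] ymin; rewrite fin_numE pN /=; apply/eqP => yoo.
have := ymin u; rewrite yoo addey // leye_eq => /eqP h.
by have := lte_add_pinfty (ltry (g u)) pu; rewrite h ltxx.
Qed.

(** First-order optimality for the sum of a smooth and a strongly convex
    function. *)
Lemma minimizer_variational psi g (mu : R) y z G : proper_fun psi ->
  econvex (fun u => (psi u - (mu / 2 * sqnorm u)%:E)%E) ->
  (forall u, ((g y)%:E + psi y <= (g u)%:E + psi u)%E) ->
  directional_gradient g y G ->
  (psi y + (mu / 2 * sqnorm (z - y) - dotp G (z - y))%:E <= psi z)%E.
Proof.
move=> pp cpsi ymin dg.
have /fineK := minimizer_fin pp ymin; set r := fine _ => yr.
have [pN _] := pp.
case zs : (psi z) => [s| |]; last first.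
- by have := pN z; rewrite zs.
- by rewrite leey.
rewrite -yr -EFinD lee_fin.
apply/ler_addgt0Pr => e e0.
set N := mu / 2 * sqnorm (z - y).
have N1 : 0 < `|N| + 1 by rewrite ltr_wpDl.
have e20 : 0 < e / 2 by rewrite divr_gt0.
have M0 : 0 < Num.min 1 (e / 2 / (`|N| + 1)) by rewrite lt_min ltr01 divr_gt0.
(* Minimality of y against y + t (z - y), for a small step t. *)
have [t [t0]] := right_witness M0 (dg (z - y) _ e20).
rewrite lt_min ler_norml => /andP[t1]; rewrite ltr_pdivlMr // => tN /andP[_ h].
have t01 : 0 < t < 1 by rewrite t0.
have := ymin (t *: z + (1 - t) *: y).
rewrite -yr => /le_trans.
move/(_ _ (leeD2l _ (econvex_strong cpsi (esym yr) zs t01))).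
have -> : t *: z + (1 - t) *: y = y + t *: (z - y).
  by rewrite scalerBl scale1r scalerBr addrCA.
rewrite -!EFinD lee_fin => h2.
have tNN : t * N <= t * (`|N| + 1).
  by rewrite ler_pM2l // (le_trans (ler_norm _)) // lerDl.
rewrite -(ler_pM2l t0).
move: h h2 tNN tN; rewrite -/N.
set gg := g _; set g0 := g y; set D := dotp _ _.
have -> : mu / 2 * (t * (1 - t) * sqnorm (z - y)) = t * (1 - t) * N.
  by rewrite /N; ring.
move=> h h2 tNN tN.
have : t * (t * N) <= t * (e / 2) by rewrite ler_pM2l //; lra.
lra.
Qed.

End StrongConvexity.

(** * The proximal operator *)

Section Prox.
Context (R : realType) (d : nat).
Implicit Types (psi : 'cV[R]_d -> \bar R) (x y z v : 'cV[R]_d).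

Lemma trmx_continuous : continuous (fun u : 'rV[R]_d => u^T).
Proof.
move=> u A [Q uQ QA]; exists (fun i j => Q j i) => [i j|w wQ].
  by have := uQ j i; rewrite mxE.
by apply: QA => i j; rewrite mxE; exact: wQ.
Qed.

Lemma cV_box_compact (a b : 'I_d -> R) :
  compact [set z : 'cV[R]_d | forall j, a j <= z j 0 <= b j].
Proof.
rewrite (_ : mkset _ = (fun u : 'rV[R]_d => u^T) @` [set u : 'rV[R]_d |
    forall j, `[a j, b j]%classic (u ord0 j)]).
  apply: (continuous_compact (continuous_subspaceT trmx_continuous)).
  apply: (@rV_compact _ _ (fun j => `[a j, b j]%classic)) => j.
  exact: segment_compact.
apply/seteqP; split=> [z h|_ [u h <-] j]; last first.
  by have := h j; rewrite /= in_itv mxE.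
by exists z^T => [j|]; rewrite ?trmxK //= in_itv mxE; exact: h.
Qed.

(** The proximal subproblem has a minimizer: an affine minorant makes it
    coercive. As [psi] takes infinite values and is only lower semicontinuous,
    the minimum is taken over points [(z, r)] of its epigraph, where the
    objective [phi] is continuous. *)
Lemma prox_exists (eta : R) psi x v (c : R) :
  0 < eta -> proper_fun psi -> closed_fun psi ->
  (forall z, ((c + dotp v z)%:E <= psi z)%E) ->
  exists y, is_prox eta psi x y.
Proof.
move=> eta0 [pN [u0 pu0]] pcl minor.
set k := (2 * eta)^-1; have k0 : 0 < k by rewrite invr_gt0 mulr_gt0.
pose phi (w : 'cV[R]_d * R) := k * sqnorm (x - w.1) + w.2.
have phic : continuous phi.
  move=> w; apply: cvgD; last exact: cvg_snd.
  apply: cvgMr.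
  apply: (@continuous_cvg _ _ _ _ _ (fun w' => x - w'.1) (@sqnorm R d)).
    exact: continuous_sqnorm.
  by apply: cvgB; [exact: cvg_cst|exact: cvg_fst].
have /fineK pu0E : psi u0 \is a fin_num by rewrite fin_numE pN lt_eqF.
set r0 := fine _ in pu0E.
pose M := phi (u0, r0).
pose C := [set w : 'cV[R]_d * R | (psi w.1 <= w.2%:E)%E]
  `&` phi @^-1` [set r | r <= M].
have C0 : C !=set0 by exists (u0, r0); split => //=; rewrite -pu0E.
have Ccl : closed C.
  apply: closedI => //; apply: closed_comp; last exact: closed_le.
  by move=> w _; exact: phic.
(* B bounds sqnorm (x - z) on C: half of the quadratic term absorbs the linear
   minorant by Young's inequality. L is the resulting lower bound on r. *)
pose V := k^-1 * sqnorm v.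
pose B := 2 / k * (M - c - dotp v x + V / 2).
pose L := c + dotp v x - k * B / 2 - V / 2.
have bound z r : C (z, r) -> sqnorm (x - z) <= B /\ L <= r <= M.
  move=> [/= pzr]; rewrite /phi /= => zrM.
  have := le_trans (minor z) pzr; rewrite lee_fin => cr.
  have := dotp_young (x - z) v k0; rewrite -/V dotpC dotpDr dotpNr => yv.
  have S0 := sqnorm_ge0 (x - z); set S := sqnorm _ in zrM yv S0 *.
  have SB : S <= B.
    rewrite -(ler_pM2l k0) /B mulrA mulrCA divff ?gt_eqF //; lra.
  have kSB : k * S <= k * B by rewrite ler_pM2l.
  have kS0 : 0 <= k * S by rewrite mulr_ge0 // ltW.
  split=> //; rewrite /L; apply/andP; split; lra.
have Cc : compact C.
  pose K := [set z : 'cV[R]_d | forall j,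
      x j 0 - (B + 1) <= z j 0 <= x j 0 + (B + 1)] `*`
    [set r | r \in `[L, M]].
  apply: (@subclosed_compact _ C K) => //.
    by apply: compact_setX; [exact: cV_box_compact|exact: segment_compact].
  move=> [z r] /bound[SB LM]; split => [j|]; last by rewrite /= in_itv.
  have := le_trans (sqr_coord_le_sqnorm (x - z) j) SB; rewrite !mxE.
  have abs_le (e b : R) : e ^+ 2 <= b -> - (b + 1) <= e <= b + 1.
    by move=> h; have := sqr_ge0 (e - 1); have := sqr_ge0 (e + 1); nra.
  by move/abs_le => /= /andP[h1 h2]; apply/andP; split; lra.
have [[y r] Cy ymin] := compact_EVT_min C0 Cc (continuous_subspaceT phic).
move: Cy; rewrite inE => -[/= pyr yM].
exists y => z; rewrite -/k.
have yle : ((k * sqnorm (x - y))%:E + psi y <= (phi (y, r))%:E)%E.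
  by rewrite /phi EFinD leeD2l.
case zs : (psi z) => [s| |]; last by have := pN z; rewrite zs.
  apply: (le_trans yle); rewrite -EFinD lee_fin.
  have [zM|/ltW zM] := leP (phi (z, s)) M; last exact: le_trans zM.
  have Czs : (psi z <= s%:E)%E by rewrite zs.
  by apply: (ymin (z, s)); rewrite inE; exact: (conj Czs zM).
by rewrite addey ?leey.
Qed.

Lemma proxP (eta : R) psi x v (c : R) :
  0 < eta -> proper_fun psi -> closed_fun psi ->
  (forall z, ((c + dotp v z)%:E <= psi z)%E) ->
  is_prox eta psi x (prox eta psi x).
Proof.
by move=> e0 pp pc minor; apply: xgetPex; exact: prox_exists minor.
Qed.

(** The proximal step is a contraction towards a minimizer [xs] of [g + psi],
    which is itself the proximal point of [xs - eta *: G]. *)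
Lemma prox_contraction (eta mu : R) psi (g : 'cV[R]_d -> R) xs G a :
  0 < eta -> 0 <= mu -> proper_fun psi -> closed_fun psi ->
  econvex (fun y => (psi y - (mu / 2 * sqnorm y)%:E)%E) ->
  (forall u, ((g xs)%:E + psi xs <= (g u)%:E + psi u)%E) ->
  directional_gradient g xs G ->
  (1 + eta * mu) * sqnorm (prox eta psi a - xs) <=
    sqnorm (a - (xs - eta *: G)).
Proof.
move=> eta0 mu0 pp pc cpsi xsmin dg.
have xsvar z := minimizer_variational z pp cpsi xsmin dg.
have xsfin := fineK (minimizer_fin pp xsmin).
set r := fine _ in xsfin.
have minor z : ((r + dotp G xs + dotp (- G) z)%:E <= psi z)%E.
  apply: le_trans (xsvar z); rewrite -xsfin -EFinD lee_fin.
  rewrite -addrA lerD2l dotpDr !(dotpNr, dotpNl) opprB lerDr.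
  by rewrite mulr_ge0 ?sqnorm_ge0 ?divr_ge0.
have yprox := proxP a eta0 pp pc minor; set y := prox _ _ _ in yprox *.
have ydg := directional_gradient_sqdist (2 * eta)^-1 a y.
have yvar := minimizer_variational xs pp cpsi yprox ydg.
have yfin := fineK (minimizer_fin pp yprox); set s := fine _ in yfin.
have := xsvar y; move: yvar.
rewrite -xsfin -yfin -!EFinD !lee_fin.
rewrite -(opprB y xs) sqnormN dotpNr dotpZl -(opprB a y) dotpNl.
have -> : a - (xs - eta *: G) = (y - xs) + (a - y + eta *: G).
  by apply/colP => j; rewrite !mxE; ring.
rewrite (sqnormD (y - xs)) !(dotpDr (a - y)) dotpZr !(dotpC _ (y - xs)).
have -> : 2 * (2 * eta)^-1 = eta^-1 by rewrite invfM mulVKf.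
have := sqnorm_ge0 (a - y + eta *: G); have := sqnorm_ge0 (y - xs).
set W := sqnorm (a - y + _); set N := sqnorm _.
set q := dotp _ (a - y); set h := dotp _ G => N0 W0 yvar xvar.
have : mu * N <= eta^-1 * q + h by lra.
rewrite -(ler_pM2l eta0) mulrDr mulVKf ?gt_eqF // => muN.
have : 0 <= eta * (mu * N) by rewrite !mulr_ge0 // ltW.
lra.
Qed.

End Prox.

(** * Averages over a sampling *)

Section SampleMean.
Context (R : realType) (n : nat) (S : sampling R n).
Implicit Types F G H : outcome S -> R.

Lemma sample_meanD F G :
  sample_mean (fun s => F s + G s) = sample_mean F + sample_mean G.
Proof. by rewrite -big_split; apply: eq_bigr => s _; rewrite mulrDr. Qed.

Lemma sample_meanZ (a : R) F :
  sample_mean (fun s => a * F s) = a * sample_mean F.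
Proof.
by rewrite /sample_mean mulr_sumr; apply: eq_bigr => s _; rewrite mulrCA.
Qed.

Lemma sample_mean_cst (a : R) : \sum_(s : outcome S) sampling_law s = 1 ->
  sample_mean (fun _ : outcome S => a) = a.
Proof. by rewrite /sample_mean -mulr_suml => ->; rewrite mul1r. Qed.

Lemma sample_mean_cstD (a : R) F : \sum_(s : outcome S) sampling_law s = 1 ->
  sample_mean (fun s => a + F s) = a + sample_mean F.
Proof. by move=> q1; rewrite sample_meanD sample_mean_cst. Qed.

Lemma sample_mean_affine (a b c e mF mG mH : R) F G H :
  \sum_(s : outcome S) sampling_law s = 1 ->
  sample_mean F = mF -> sample_mean G = mG -> sample_mean H = mH ->
  sample_mean (fun s => a * F s + (b * G s + (c * H s + e))) =
  a * mF + (b * mG + (c * mH + e)).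
Proof.
by move=> q1 <- <- <-; rewrite !sample_meanD !sample_meanZ sample_mean_cst.
Qed.

Lemma le_sample_mean F G : (forall s : outcome S, 0 <= sampling_law s) ->
  (forall s, F s <= G s) -> sample_mean F <= sample_mean G.
Proof. by move=> q0 FG; apply: ler_sum => s _; rewrite ler_wpM2l. Qed.

Lemma sample_mean_dotp d (u : 'cV[R]_d) (V : outcome S -> 'cV[R]_d) :
  sample_mean (fun s => dotp u (V s)) = dotp u (\sum_s sampling_law s *: V s).
Proof. by rewrite dotp_sumr; apply: eq_bigr => s _; rewrite dotpZr. Qed.

End SampleMean.

(** * One iteration *)

(** Expected squared norm of the sampled gradient difference between [y] and
    [xs]; written V below. *)
Definition sampled_sqdist (R : realType) (d n : nat)
    (f : 'I_n -> 'cV[R]_d -> R) (S : sampling R n) (xs y : 'cV[R]_d) : R :=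
  sample_mean (fun s : outcome S => sqnorm (sampled_diff f s y xs)).

(** Bregman divergence of [g] at [y], based at [x]. *)
Definition bregman (R : realType) (d : nat) (g : 'cV[R]_d -> R)
    (x y : 'cV[R]_d) : R :=
  g y - g x - dotp (grad g x) (y - x).

Section OneStep.
Context (R : realType) (d n : nat).
Variables (f : 'I_n -> 'cV[R]_d -> R) (psi : 'cV[R]_d -> \bar R).
Variables (S : sampling R n).
Hypothesis df : forall i y, differentiable (f i) y.
Implicit Types x w y xs : 'cV[R]_d.

Lemma differentiable_favg y : differentiable (favg f) y.
Proof.
rewrite /favg; apply: differentiableM; first exact: differentiable_cst.
have -> : (fun u => \sum_i f i u) = \sum_i f i.
  by apply/funext => u; rewrite fct_sumE.
exact: differentiable_sum.
Qed.

Lemma grad_favg y : grad (favg f) y = n%:R^-1 *: (grad_mx f y *m ones).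
Proof.
apply/colP => j; rewrite !mxE.
have -> : favg f = n%:R^-1 *: \sum_i f i.
  by apply/funext => u; rewrite /favg fct_sumE.
have dfi i : derivable (f i) y (delta_mx j 0) by exact: diff_derivable.
rewrite deriveZ; last exact: derivable_sum.
rewrite derive_sum //; congr (_ *: _).
by apply: eq_bigr => i _; rewrite !mxE mulr1.
Qed.

Lemma sampled_diffB (s : outcome S) x w y :
  sampled_diff f s x w = sampled_diff f s x y - sampled_diff f s w y.
Proof.
rewrite /sampled_diff -scalerBr -!mulmxBl.
by rewrite [_ - _ - _](_ : _ = grad_mx f x - grad_mx f w) // opprB addrA subrK.
Qed.

Hypothesis unb : unbiased S.

Lemma sampled_diff_mean x w :
  \sum_(s : outcome S) sampling_law s *: sampled_diff f s x w =
  grad (favg f) x - grad (favg f) w.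
Proof.
rewrite !grad_favg -scalerBr -mulmxBl -[in RHS]unb.
rewrite mulmxA mulmx_sumr mulmx_suml scaler_sumr.
apply: eq_bigr => s _; rewrite /sampled_diff scalerA mulrC -scalerA.
by rewrite -scalemxAr -scalemxAl mulmxA.
Qed.

Variable xs : 'cV[R]_d.
Hypothesis q_ge0 : forall s : outcome S, 0 <= sampling_law s.
Hypothesis q_sum : \sum_(s : outcome S) sampling_law s = 1.

Let gs := grad (favg f) xs.
Local Notation V := (sampled_sqdist f S xs).

Lemma svrg_gradE (s : outcome S) x w :
  svrg_grad f s x w - gs =
  sampled_diff f s x xs - (sampled_diff f s w xs - (grad (favg f) w - gs)).
Proof.
rewrite /svrg_grad -grad_favg (sampled_diffB _ x w xs) opprB -!addrA.
by congr (_ + _); rewrite addrC -addrA.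
Qed.

(** The estimator is unbiased, in the form in which it is used. *)
Lemma svrg_grad_mean x w u :
  sample_mean (fun s : outcome S => dotp u (svrg_grad f s x w - gs)) =
  dotp u (grad (favg f) x - gs).
Proof.
rewrite sample_mean_dotp; congr dotp.
transitivity (\sum_(s : outcome S)
   (sampling_law s *: sampled_diff f s x w
    + sampling_law s *: (grad (favg f) w - gs))).
  by apply: eq_bigr => s _; rewrite /svrg_grad -grad_favg -scalerDr addrA.
rewrite big_split /= sampled_diff_mean -scaler_suml q_sum scale1r.
by rewrite addrA subrK.
Qed.

(** Second moment of the estimator. By [svrg_gradE] it splits into an [x]-part
    and a centred [w]-part, whose variance is at most its second moment. *)
Lemma svrg_grad_second_moment x w :
  sample_mean (fun s : outcome S => sqnorm (svrg_grad f s x w - gs)) <=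
  2 * V x + 2 * V w.
Proof.
pose b := grad (favg f) w - gs.
have mb : sample_mean (fun s : outcome S => dotp b (sampled_diff f s w xs)) =
    sqnorm b.
  by rewrite sample_mean_dotp sampled_diff_mean.
(* The bound 2 |A|^2 + 2 |B - b|^2 <= 2 |A|^2 + (2 |B|^2 - 4 <b, B> + 4 |b|^2)
   holds pointwise, and its last two terms cancel on average. *)
have cancel_b (u v t : R) : 2 * u + 2 * v = 2 * u + (2 * v + (-4 * t + 4 * t)).
  by ring.
rewrite (cancel_b _ _ (sqnorm b)).
rewrite -(sample_mean_affine 2 2 (-4) (4 * sqnorm b) q_sum
  (erefl (V x)) (erefl (V w)) mb).
apply: le_sample_mean => // s; rewrite svrg_gradE -/b.
move: (sampled_diff _ _ x _) (sampled_diff _ _ w _) b {mb} => A B b.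
have := sqnorm_ge0 (A + (B - b)); have := sqnorm_ge0 b.
rewrite (sqnormD A) (sqnormB A) (sqnormB B) (dotpC B b).
move: (sqnorm A) (sqnorm B) (sqnorm b) (dotp b B) (dotp A _) => ? ? ? ? ?.
lra.
Qed.

Variables (eta p mu_f mu_psi L1 : R).
Hypothesis (eta0 : 0 < eta) (p01 : 0 < p <= 1).
Hypothesis (mu_psi0 : 0 <= mu_psi).
Hypothesis (pp : proper_fun psi) (pc : closed_fun psi).
Hypothesis cf : convex_on_space (fun y => favg f y - mu_f / 2 * sqnorm y).
Hypothesis cpsi : econvex (fun y => (psi y - (mu_psi / 2 * sqnorm y)%:E)%E).
Hypothesis xsmin : is_minimizer f psi xs.

Local Notation breg := (bregman (favg f) xs).

(** Mean squared distance after the proximal step, in terms of the Bregman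
    divergence and of the second moment of the estimator. *)
Lemma svrg_prox_step x w :
  (1 + eta * mu_psi) * sample_mean (fun s : outcome S =>
    sqnorm (prox eta psi (x - eta *: svrg_grad f s x w) - xs)) <=
  (1 - eta * mu_f) * sqnorm (x - xs) - 2 * eta * breg x
    + eta ^+ 2 * (2 * V x + 2 * V w).
Proof.
have dgs : directional_gradient (favg f) xs gs.
  exact/differentiable_directional_gradient/differentiable_favg.
have step : (1 + eta * mu_psi) * sample_mean (fun s : outcome S =>
      sqnorm (prox eta psi (x - eta *: svrg_grad f s x w) - xs)) <=
    sqnorm (x - xs) - 2 * eta * dotp (x - xs) (grad (favg f) x - gs)
    + eta ^+ 2 * (2 * V x + 2 * V w).
  rewrite -sample_meanZ.
  apply: le_trans (lerD (lexx _) (ler_wpM2l (sqr_ge0 eta)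
    (svrg_grad_second_moment x w))).
  rewrite -(svrg_grad_mean x w (x - xs)) -[X in X - _](sample_mean_cst _ q_sum).
  rewrite -mulNr -!sample_meanZ -!sample_meanD.
  apply: le_sample_mean => // s.
  apply: le_trans (prox_contraction _ eta0 mu_psi0 pp pc cpsi xsmin dgs) _.
  have -> : x - eta *: svrg_grad f s x w - (xs - eta *: gs) =
      (x - xs) - eta *: (svrg_grad f s x w - gs).
    by apply/colP => j; rewrite !mxE; ring.
  rewrite (sqnormB (x - xs)) sqnormZ dotpZr.
  lra.
apply: le_trans step _; rewrite lerD2r.
have dgx : directional_gradient (favg f) x (grad (favg f) x).
  exact/differentiable_directional_gradient/differentiable_favg.
have := strongly_convex_lower xs cf dgx.
rewrite -(opprB x xs) sqnormN dotpNr /bregman -/gs.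
rewrite dotpDr dotpNr (dotpC _ gs) (dotpC _ (grad _ x)).
set N := sqnorm _; set D1 := dotp _ _; set D2 := dotp gs _ => h.
have := ler_wpM2l (ltW eta0) h.
lra.
Qed.

Hypothesis L10 : 0 < L1.
Hypothesis smooth : forall y, V y <= 2 * L1 * breg y.
Hypothesis eta_le : eta <= 1 / (6 * L1).

Local Notation mD y :=
  (sample_mean (fun c : outcome S => Dquant f eta p mu_psi xs c y)).

(** One iteration from fixed points [x] and [w], the coin being averaged out. *)
Lemma one_step x w :
  sample_mean (fun s : outcome S =>
    sqnorm (prox eta psi (x - eta *: svrg_grad f s x w) - xs))
    + (p * mD x + (1 - p) * mD w) <=
  (1 - eta * (mu_f + mu_psi) / (1 + eta * mu_psi)) * sqnorm (x - xs)
    + (1 - p / 2) * mD w.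
Proof.
have [p0 p1] := andP p01.
have c0 : 0 < 1 + eta * mu_psi by rewrite ltr_wpDr // mulr_ge0 // ltW.
have mDE y : (1 + eta * mu_psi) * (p * mD y) = 4 * eta ^+ 2 * V y.
  rewrite /Dquant sample_meanZ -/(V y); move: (V y) => v.
  by field; rewrite !gt_eqF.
have B0 : 0 <= 2 * L1 * breg x.
  apply: le_trans (smooth x); apply: sumr_ge0 => s _.
  by rewrite mulr_ge0 ?sqnorm_ge0.
have e2V : eta ^+ 2 * V x <= eta ^+ 2 * (2 * L1 * breg x).
  by rewrite ler_wpM2l ?sqr_ge0.
have b0 : 0 <= breg x by rewrite pmulr_rge0 ?mulr_gt0 in B0.
have e2B B : 0 <= B -> eta ^+ 2 * (2 * L1 * B) <= eta * (B / 3).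
  move=> b0'; rewrite expr2 -mulrA ler_pM2l //.
  have : eta * (6 * L1) <= 1 by rewrite -ler_pdivlMr ?mulr_gt0.
  by move=> /(ler_wpM2r b0'); lra.
have arith (T Dx Dw Vx Vw B N : R) :
    (1 + eta * mu_psi) * (p * Dx) = 4 * eta ^+ 2 * Vx ->
    (1 + eta * mu_psi) * (p * Dw) = 4 * eta ^+ 2 * Vw ->
    0 <= B -> eta ^+ 2 * Vx <= eta ^+ 2 * (2 * L1 * B) ->
    (1 + eta * mu_psi) * T <= (1 - eta * mu_f) * N - 2 * eta * B
      + eta ^+ 2 * (2 * Vx + 2 * Vw) ->
    T + (p * Dx + (1 - p) * Dw) <=
    (1 - eta * (mu_f + mu_psi) / (1 + eta * mu_psi)) * N + (1 - p / 2) * Dw.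
  move=> mDx mDw /e2B e2B' e2V' stepx; rewrite -(ler_pM2l c0).
  have -> : (1 + eta * mu_psi) *
      ((1 - eta * (mu_f + mu_psi) / (1 + eta * mu_psi)) * N
       + (1 - p / 2) * Dw) =
     (1 - eta * mu_f) * N + (1 + eta * mu_psi) * Dw
       - (1 + eta * mu_psi) * (p * Dw) / 2.
    by field; rewrite gt_eqF.
  have -> : (1 + eta * mu_psi) * (T + (p * Dx + (1 - p) * Dw)) =
    (1 + eta * mu_psi) * T + (1 + eta * mu_psi) * (p * Dx)
    + (1 + eta * mu_psi) * Dw - (1 + eta * mu_psi) * (p * Dw) by ring.
  rewrite mDx mDw; lra.
exact: (arith _ _ _ _ _ _ _ (mDE x) (mDE w) b0 e2V (svrg_prox_step x w)).
Qed.

End OneStep.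

(** * Random elements with finitely many values *)

Section FiniteLaw.
Context (disp : measure_display) (T : measurableType disp) (R : realType).
Variable P : probability T R.
Variables (V : finType) (X : T -> V) (q : V -> R).
Hypothesis Xq : has_law P X q.

Lemma has_law_ge0 v : 0 <= q v.
Proof. by have [_ Pq] := Xq v; rewrite -lee_fin -Pq measure_ge0. Qed.

Lemma has_law_measurable (B : set V) : measurable (X @^-1` B).
Proof.
rewrite (_ : X @^-1` B = \bigcup_(v in B) X @^-1` [set v]).
  by apply: fin_bigcup_measurable => // v _; have [] := Xq v.
by apply/seteqP; split=> [t Bt|t [v Bv /= ->]] //; exists (X t).
Qed.

Lemma expectation_has_law (F : V -> R) :
  ('E_P[fun t => F (X t)] = (\sum_v q v * F v)%:E)%E.
Proof.
rewrite unlock.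
under eq_integral => t _.
  rewrite (_ : (F (X t))%:E =
      (\sum_(v : V) (F v)%:E * (\1_(X @^-1` [set v]) t)%:E)%E); last first.
    rewrite (bigD1 (X t)) //= indicE mem_set // mule1 big1 ?adde0 // => v vX.
    by rewrite indicE memNset ?mule0 //= => vE; rewrite vE eqxx in vX.
  over.
have mX v : measurable (X @^-1` [set v]) by have [] := Xq v.
have iX v : P.-integrable setT (fun t => (\1_(X @^-1` [set v]) t)%:E).
  exact: integrable_indic.
rewrite integral_sum //; last by move=> v; exact: integrableZl.
rewrite -sumEFin; apply: eq_bigr => v _.
rewrite integralZl // integral_indic // setIT.
by have [_ Pv] := Xq v; rewrite EFinM -Pv muleC.
Qed.

Lemma has_law_sum1 : \sum_v q v = 1.
Proof.
apply/EFin_inj; rewrite -(expectation_cst P 1) (expectation_has_law (fun=> 1)).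
by under [in RHS]eq_bigr do rewrite mulr1.
Qed.

Lemma probability_has_law (B : pred V) :
  (P (X @^-1` [set` B]) = (\sum_v q v * (B v)%:R)%:E)%E.
Proof.
rewrite -expectation_indic; last exact: has_law_measurable.
rewrite -(expectation_has_law (fun v => (B v)%:R)); congr expectation.
by apply/funext => t; rewrite indicE /= ; congr (_%:R); rewrite mem_setE.
Qed.

(** A random element with finitely many values almost surely avoids the values
    of probability 0. *)
Lemma ae_has_law_neq0 : {ae P, forall t, q (X t) != 0}.
Proof.
have : {ae P, forall t, forall v : V, q v = 0 -> X t <> v}.
  apply: filter_forall => v.
  have [v0|/eqP v0] := eqVneq (q v) 0; last by apply: aeW => t /v0.
  have [mv Pv] := Xq v; exists (X @^-1` [set v]); split => //.
    by rewrite Pv v0.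
  by move=> t /= /not_implyP[_ /contrapT].
by apply: filterS => t h; apply/eqP => /h; apply.
Qed.

End FiniteLaw.

(** Conditional expectation given [Z (X)], when both the conditioning element
    and the integrand are functions of the same finitely valued [X]. *)
Lemma cond_expectation_has_law (disp : measure_display)
    (T : measurableType disp) (R : realType) (P : probability T R)
    (V : finType) (X : T -> V) (q : V -> R) (W : eqType) (Z : V -> W)
    (F : V -> R) (t : T) :
  has_law P X q ->
  cond_expectation P (fun u => Z (X u)) (fun u => F (X u)) t =
  ((fine (P [set u | Z (X u) = Z (X t)]))^-1 *
    \sum_v q v * (F v * (Z v == Z (X t))%:R))%:E.
Proof.
move=> Xq; rewrite /cond_expectation EFinM; congr (_ * _)%E.
rewrite -(expectation_has_law Xq (fun v => F v * (Z v == Z (X t))%:R)).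
congr expectation; apply/funext => u /=; congr (_ * _).
rewrite indicE; congr ((nat_of_bool _)%:R).
by apply/idP/eqP => [/set_mem|/mem_set].
Qed.

(** * Law of the history of draws and coins *)

Section HistoryDef.
Context (T : Type) (R : realType) (n : nat) (S : sampling R n) (p : R).
Variables (draw : nat -> T -> outcome S) (coin : nat -> T -> bool).

(** Type of the realized values of the first [k] draws and coins. *)
Fixpoint hist_type (k : nat) : finType :=
  match k with
  | 0%N => unit
  | k'.+1 => (hist_type k' * outcome S * bool)%type
  end.

Fixpoint history (k : nat) (t : T) : hist_type k :=
  match k return hist_type k with
  | 0%N => tt
  | k'.+1 => (history k' t, draw k' t, coin k' t)
  end.

(** Probability of a realized history. *)
Fixpoint hist_law (k : nat) : hist_type k -> R :=
  match k return hist_type k -> R with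
  | 0%N => fun=> 1
  | k'.+1 => fun h =>
      hist_law h.1.1 * sampling_law h.1.2 * (if h.2 then p else 1 - p)
  end.

End HistoryDef.

Section History.
Context (disp : measure_display) (T : measurableType disp) (R : realType).
Variable P : probability T R.
Variables (n : nat) (S : sampling R n) (p : R).
Variables (draw : nat -> T -> outcome S) (coin : nat -> T -> bool).
Variable (copy : T -> outcome S).
Hypothesis rnd : lsvrg_randomness P p draw coin copy.

(* The events generated by the i-th source of randomness, and the sources that
   the first k iterations do not use. *)
Let family (i : nat + nat + unit) : set_system T :=
  match i with
  | inl (inl k) => events_of (draw k)
  | inl (inr k) => events_of (coin k)
  | inr _ => events_of copy
  end.

Let future (k : nat) (i : nat + nat + unit) : bool :=
  match i with
  | inl (inl j) => (k <= j)%N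
  | inl (inr j) => (k <= j)%N
  | inr _ => true
  end.

Let events_of_preim (V : finType) (X : T -> V) v :
  events_of X (X @^-1` [set v]).
Proof. by exists [set v]; rewrite ?setTI. Qed.

(** The history up to time [k] has law [hist_law] and is independent of the
    later draws and coins and of the copy. *)
Lemma history_independent k (h : hist_type S k) (J : seq (nat + nat + unit))
    (E : nat + nat + unit -> set T) :
  uniq J -> all (future k) J -> (forall i, i \in J -> family i (E i)) ->
  P (history draw coin k @^-1` [set h] `&` \big[setI/setT]_(i <- J) E i) =
    ((hist_law p h)%:E * \prod_(i <- J) P (E i))%E.
Proof.
have [draw_law coin_lawP copy_law indep] := rnd.
elim: k h J E => [|k IH] h J E uJ fJ EJ.
  rewrite [X in X `&` _](_ : _ = setT); last first.
    by case: h; apply/seteqP; split=> t.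
  by rewrite setTI mul1e; exact: indep.
case: h => [[h s] b] /=.
pose i1 : nat + nat + unit := inl (inl k).
pose i2 : nat + nat + unit := inl (inr k).
have i1J : i1 \notin J.
  by apply: contraL fJ => i1J; apply/allPn; exists i1; rewrite //= ltnn.
have i2J : i2 \notin J.
  by apply: contraL fJ => i2J; apply/allPn; exists i2; rewrite //= ltnn.
(* The last draw and coin of the history become two more events. *)
pose E' i := if i == i1 then draw k @^-1` [set s]
  else if i == i2 then coin k @^-1` [set b] else E i.
have E'J i : i \in J -> E' i = E i.
  move=> iJ; rewrite /E' !ifN //; last by apply: contraNneq i1J => <-.
  by apply: contraNneq i2J => <-.
have uJ' : uniq [:: i1, i2 & J] by rewrite /= inE i1J i2J uJ.
have fJ' : all (future k) [:: i1, i2 & J].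
  rewrite /= leqnn /=; apply: sub_all fJ => -[[j|j]|u] //= /ltnW; exact.
have EJ' i : i \in [:: i1, i2 & J] -> family i (E' i).
  rewrite !inE => /or3P[/eqP->|/eqP->|iJ]; last by rewrite E'J //; exact: EJ.
    by rewrite /E' eqxx; exact: events_of_preim.
  by rewrite /E' /= eqxx; exact: events_of_preim.
have := IH h [:: i1, i2 & J] E' uJ' fJ' EJ'.
rewrite !big_cons (eq_big_seq _ E'J).
have -> : (\prod_(i <- J) P (E' i) = \prod_(i <- J) P (E i))%E.
  by apply: eq_big_seq => i iJ; rewrite E'J.
have -> : E' i1 = draw k @^-1` [set s] by rewrite /E' eqxx.
have -> : E' i2 = coin k @^-1` [set b] by rewrite /E' /= eqxx.
have [_ ->] := draw_law k s; have [_ ->] := coin_lawP k b.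
rewrite !EFinM !muleA => <-; congr (P _).
rewrite !setIA; congr (_ `&` _).
by apply/seteqP; split=> t /= => [[-> -> ->]|[[-> ->] ->]].
Qed.

Lemma history_has_law k : has_law P (history draw coin k) (@hist_law _ _ S p k).
Proof.
move=> h; split; last first.
  have := @history_independent k h [::] (fun=> setT) isT isT.
  by rewrite !big_nil setIT mule1; exact.
have [draw_law coin_lawP _ _] := rnd.
elim: k h => [|k IH] h /=.
  rewrite [X in measurable X](_ : _ = setT) //.
  by case: h; apply/seteqP; split=> t.
case: h => [[h s] b].
rewrite [X in measurable X](_ : _ = history draw coin k @^-1` [set h] `&`
    (draw k @^-1` [set s] `&` coin k @^-1` [set b])).
  apply: measurableI => //; apply: measurableI.
    by have [] := draw_law k s.
  by have [] := coin_lawP k b.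
by apply/seteqP; split=> t /= => [[-> -> ->]|[-> [-> ->]]].
Qed.

Lemma history_copy_has_law k :
  has_law P (fun t => (history draw coin k t, copy t))
    (fun u => hist_law p u.1 * sampling_law u.2).
Proof.
move=> [h c]; have [mc Pc] : _ /\ _ := let: And4 _ _ cl _ := rnd in cl c.
have [mh _] := history_has_law h.
have -> : (fun t => (history draw coin k t, copy t)) @^-1` [set (h, c)] =
    history draw coin k @^-1` [set h] `&` copy @^-1` [set c].
  by apply/seteqP; split=> t /= => [[-> ->]|[-> ->]].
split; first exact: measurableI.
have := @history_independent k h [:: inr tt] (fun=> copy @^-1` [set c]) isT isT.
rewrite !big_seq1 Pc -EFinM; apply=> i; rewrite inE => /eqP ->.
exact: events_of_preim.
Qed.

End History.

(** * The iteration averaged over the history *)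

(** Average of one iteration over the current draw [s], the current coin [b] and
    the copy [c], for a history of probability [a] and weight [o]. *)
Lemma draw_coin_copy_average (R : realType) (n : nat) (S : sampling R n)
    (p a o : R) (A : outcome S -> R) (B : bool -> outcome S -> R) :
  \sum_(s : outcome S) sampling_law s = 1 ->
  \sum_(s : outcome S) \sum_(b : bool) \sum_(c : outcome S)
    (a * sampling_law s * (if b then p else 1 - p) * sampling_law c) *
      ((A s + B b c) * o) =
  a * (o * (sample_mean A
    + (p * sample_mean (B true) + (1 - p) * sample_mean (B false)))).
Proof.
move=> q1.
have inner s b : \sum_(c : outcome S)
    (a * sampling_law s * (if b then p else 1 - p) * sampling_law c) *
      ((A s + B b c) * o) =
    a * o * (if b then p else 1 - p) *
      (sampling_law s * A s + sampling_law s * sample_mean (B b)).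
  transitivity (a * sampling_law s * (if b then p else 1 - p) * o *
      sample_mean (fun c => A s + B b c)).
    by rewrite mulr_sumr; apply: eq_bigr => c _; ring.
  by rewrite sample_meanD sample_mean_cst //; ring.
transitivity (\sum_(s : outcome S)
    a * o * (sampling_law s * A s + sampling_law s *
     (p * sample_mean (B true) + (1 - p) * sample_mean (B false)))).
  apply: eq_bigr => s _; under eq_bigr do rewrite inner.
  by rewrite big_bool /=; ring.
by rewrite -mulr_sumr big_split /= -mulr_suml q1 mul1r mulrA.
Qed.

Section Iterates.
Context (R : realType) (d n : nat).
Variables (f : 'I_n -> 'cV[R]_d -> R) (psi : 'cV[R]_d -> \bar R).
Variables (S : sampling R n) (xs x0 : 'cV[R]_d).
Variables (eta p mu_f mu_psi L1 : R).

(** The iterates as functions of the realized history. *)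
Fixpoint iterates (k : nat) : hist_type S k -> 'cV[R]_d * 'cV[R]_d :=
  match k return hist_type S k -> 'cV[R]_d * 'cV[R]_d with
  | 0%N => fun=> (x0, x0)
  | k'.+1 => fun h =>
      let: (x, w) := iterates h.1.1 in
      (prox eta psi (x - eta *: svrg_grad f h.1.2 x w), if h.2 then x else w)
  end.

Lemma lsvrg_iterates (T : Type) (draw : nat -> T -> outcome S)
    (coin : nat -> T -> bool) k t :
  lsvrg f psi eta x0 (draw^~ t) (coin^~ t) k = iterates (history draw coin k t).
Proof. by elim: k => //= k ->. Qed.

Local Notation sqx h := (sqnorm ((iterates h).1 - xs)).
Local Notation D c h := (Dquant f eta p mu_psi xs c (iterates h).2).
Local Notation mD y :=
  (sample_mean (fun c : outcome S => Dquant f eta p mu_psi xs c y)).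

Lemma history_copy_sum k (F : hist_type S k * outcome S -> R)
    (o : hist_type S k -> R) :
  \sum_(u : hist_type S k * outcome S)
    (hist_law p u.1 * sampling_law u.2) * (F u * o u.1) =
  \sum_h hist_law p h * (o h * sample_mean (fun c => F (h, c))).
Proof.
transitivity (\sum_h \sum_c (hist_law p h * sampling_law c) * (F (h, c) * o h)).
  by rewrite pair_bigA; apply: eq_bigr => -[].
apply: eq_bigr => h _; rewrite /sample_mean !mulr_sumr.
by apply: eq_bigr => c _; ring.
Qed.

Hypothesis q_sum : \sum_(s : outcome S) sampling_law s = 1.
Hypothesis q_ge0 : forall s : outcome S, 0 <= sampling_law s.
Hypothesis law_ge0 : forall k (h : hist_type S k), 0 <= hist_law p h.
Hypothesis df : forall i y, differentiable (f i) y.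
Hypothesis unb : unbiased S.
Hypothesis (eta0 : 0 < eta) (p01 : 0 < p <= 1).
Hypothesis (mu_psi0 : 0 <= mu_psi).
Hypothesis (pp : proper_fun psi) (pc : closed_fun psi).
Hypothesis cf : convex_on_space (fun y => favg f y - mu_f / 2 * sqnorm y).
Hypothesis cpsi : econvex (fun y => (psi y - (mu_psi / 2 * sqnorm y)%:E)%E).
Hypothesis xsmin : is_minimizer f psi xs.
Hypothesis L10 : 0 < L1.
Hypothesis smooth : forall y,
  sampled_sqdist f S xs y <= 2 * L1 * bregman (favg f) xs y.
Hypothesis eta_le : eta <= 1 / (6 * L1).

(** The one-step bound averaged over the history with weights [o]; the weights
    are 1 for the expectation and an indicator for the conditional one. *)
Lemma weighted_step k (o : hist_type S k -> R) : (forall h, 0 <= o h) ->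
  \sum_(u : hist_type S k.+1 * outcome S)
    (hist_law p u.1 * sampling_law u.2) *
      ((sqx u.1 + D u.2 u.1) * o u.1.1.1) <=
  \sum_(h : hist_type S k) hist_law p h * (o h *
    ((1 - eta * (mu_f + mu_psi) / (1 + eta * mu_psi)) * sqx h
     + (1 - p / 2) * mD (iterates h).2)).
Proof.
move=> o0.
rewrite -(pair_bigA _ (fun (h : hist_type S k.+1) c =>
  (hist_law p h * sampling_law c) * ((sqx h + D c h) * o h.1.1))) /=.
rewrite -(pair_bigA _ (fun hs b => \sum_(c : outcome S)
  (hist_law p ((hs, b) : hist_type S k.+1) * sampling_law c) *
  ((sqx ((hs, b) : hist_type S k.+1) + D c ((hs, b) : hist_type S k.+1))
    * o hs.1))) /=.
rewrite -(pair_bigA _ (fun h s => \sum_(b : bool) \sum_(c : outcome S)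
  (hist_law p ((h, s, b) : hist_type S k.+1) * sampling_law c) *
  ((sqx ((h, s, b) : hist_type S k.+1) + D c ((h, s, b) : hist_type S k.+1))
    * o h))) /=.
apply: ler_sum => h _; case: (iterates h) => x w /=.
rewrite (draw_coin_copy_average p (hist_law p h) (o h)
  (fun s => sqnorm (prox eta psi (x - eta *: svrg_grad f s x w) - xs))
  (fun (b : bool) c => Dquant f eta p mu_psi xs c (if b then x else w)) q_sum).
apply: ler_wpM2l; first exact: law_ge0.
apply: ler_wpM2l; first exact: o0.
exact: (one_step df unb q_ge0 q_sum eta0 p01 mu_psi0 pp pc cf cpsi xsmin L10
  smooth eta_le).
Qed.

(** Expected Lyapunov function at time [k]. *)
Definition lyapunov k : R :=
  \sum_(h : hist_type S k) hist_law p h * (sqx h + mD (iterates h).2).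

Lemma mean_Dquant_ge0 y : 0 <= mD y.
Proof.
have [p0 _] := andP p01.
apply: sumr_ge0 => c _; rewrite mulr_ge0 // /Dquant mulr_ge0 ?sqnorm_ge0 //.
rewrite mulr_ge0 // ?invr_ge0 ?addr_ge0 ?mulr_ge0 ?sqr_ge0 ?invr_ge0 //;
  exact: ltW.
Qed.

Lemma lyapunov_ge0 k : 0 <= lyapunov k.
Proof.
apply: sumr_ge0 => h _; rewrite mulr_ge0 // addr_ge0 ?sqnorm_ge0 //.
exact: mean_Dquant_ge0.
Qed.

Lemma lyapunov_step (rho : R) k :
  1 - eta * (mu_f + mu_psi) / (1 + eta * mu_psi) <= rho -> 1 - p / 2 <= rho ->
  lyapunov k.+1 <= rho * lyapunov k.
Proof.
move=> r1 r2; rewrite /lyapunov.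
have := @weighted_step k (fun=> 1) (fun=> ler01).
rewrite (@history_copy_sum k.+1 (fun u => sqx u.1 + D u.2 u.1) (fun=> 1)) /=.
under eq_bigr => h _ do rewrite mul1r (sample_mean_cstD _ _ q_sum).
move=> /le_trans; apply; rewrite mulr_sumr; apply: ler_sum => h _.
rewrite mul1r [leRHS]mulrCA ler_wpM2l // [leRHS]mulrDr.
rewrite lerD // ler_wpM2r ?sqnorm_ge0 //.
exact: mean_Dquant_ge0.
Qed.

Lemma lyapunov_rate (rho : R) k : 0 <= rho ->
  1 - eta * (mu_f + mu_psi) / (1 + eta * mu_psi) <= rho -> 1 - p / 2 <= rho ->
  lyapunov k <= rho ^+ k * lyapunov 0.
Proof.
move=> r0 r1 r2; elim: k => [|k IH]; first by rewrite mul1r.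
rewrite exprS -mulrA; apply: (le_trans (lyapunov_step k r1 r2)).
by rewrite ler_wpM2l.
Qed.

End Iterates.

(** * Iteration complexity *)

Lemma contraction_iterations (R : realType) (A eps : R) (k : nat) :
  0 < A -> 0 < eps -> 1 / A <= 1 -> A * ln (1 / eps) <= k%:R ->
  (1 - 1 / A) ^+ k <= eps.
Proof.
move=> A0 e0 A1; rewrite div1r lnV ?posrE // mulrN lerNl => h.
rewrite -[leRHS]lnK ?posrE //.
apply: (@le_trans _ _ (expR (- (1 / A)) ^+ k)).
  by rewrite lerXn2r ?nnegrE ?expR_ge0 ?subr_ge0 // expR_ge1Dx.
rewrite -expRM_natl ler_expR mulrN mulrA mulr1 -mulNr ler_pdivrMr //.
by rewrite mulrC.
Qed.

(** Both contraction factors are at most [1 - 1 / A]: the step size gives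
    [eta * mu / (1 + eta * mu_psi) = mu / (6 * L1 + mu_psi)], where
    [mu_psi <= mu <= mu / p]. *)
Lemma lsvrg_rate_le (R : realType) (p L1 mu_f mu_psi : R) :
  let mu := mu_f + mu_psi in let eta := 1 / (6 * L1) in
  let A := 6 * (1 / p + L1 / mu) in
  0 < p <= 1 -> 0 < L1 -> 0 <= mu_f -> 0 <= mu_psi -> 0 < mu ->
  [/\ 0 < A, 1 / A <= 1, 1 - p / 2 <= 1 - 1 / A &
      1 - eta * mu / (1 + eta * mu_psi) <= 1 - 1 / A].
Proof.
move=> mu eta A /andP[p0 p1] L0 mf mp mu0.
have ip : 1 <= 1 / p by rewrite ler_pdivlMr // mul1r.
have r0 : 0 < L1 / mu by rewrite divr_gt0.
have A0 : 0 < A by rewrite /A; lra.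
have pA : p / 2 >= 1 / A.
  rewrite ler_pdivrMr // /A mulrC mulrA mulrDl mulrDr.
  have : p * (1 / p) = 1 by rewrite div1r divff // gt_eqF.
  have := mulr_gt0 p0 r0; lra.
split=> //; first by rewrite ler_pdivrMr // mul1r /A; lra.
  by rewrite lerD2l lerN2.
rewrite lerD2l lerN2 /eta.
have e0 : 0 < 6 * L1 + mu_psi by lra.
have -> : 1 / (6 * L1) * mu / (1 + 1 / (6 * L1) * mu_psi) =
    mu / (6 * L1 + mu_psi).
  by field; rewrite !gt_eqF //; lra.
rewrite ler_pdivrMr // mulrAC ler_pdivlMr // mul1r /A.
have -> : mu * (6 * (1 / p + L1 / mu)) = 6 * (mu * (1 / p)) + 6 * L1.
  by field; rewrite !gt_eqF.
have := ler_wpM2l (ltW mu0) ip; rewrite /mu; lra.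
Qed.

Theorem theorem3p1 (R : realType) :
  exists2 c : R, 0 < c &
  forall (d n : nat) (f : 'I_n -> 'cV[R]_d -> R) (psi : 'cV[R]_d -> \bar R)
    (S : sampling R n) (xs x0 : 'cV[R]_d)
    (eta p L_f mu_f mu_psi L1 : R)
    (disp : measure_display) (T : measurableType disp) (P : probability T R)
    (draw : nat -> T -> outcome S) (coin : nat -> T -> bool)
    (copy : T -> outcome S),
  let mu := mu_f + mu_psi in
  let x k t := (lsvrg f psi eta x0 (draw^~ t) (coin^~ t) k).1 in
  let w k t := (lsvrg f psi eta x0 (draw^~ t) (coin^~ t) k).2 in
  let D k t := Dquant f eta p mu_psi xs (copy t) (w k t) in
  let E_ k Y := cond_expectation P (fun t => (x k t, w k t)) Y in
  let Psi k t := sqnorm (x k t - xs) + D k t in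
  (0 < n)%N ->
  (forall i y, differentiable (f i) y) ->
  proper_fun psi -> closed_fun psi -> econvex psi ->
  is_minimizer f psi xs ->
  valid_sampling S -> unbiased S ->
  lsvrg_randomness P p draw coin copy ->
  0 < eta -> 0 < p <= 1 ->
  0 < L_f -> 0 <= mu_f -> 0 <= mu_psi -> 0 < mu ->
  convex_on_space (fun y => L_f / 2 * sqnorm y - favg f y) ->
  convex_on_space (fun y => favg f y - mu_f / 2 * sqnorm y) ->
  econvex (fun y => (psi y - (mu_psi / 2 * sqnorm y)%:E)%E) ->
  0 < L1 ->
  (forall y, sample_mean (fun s : outcome S => sqnorm (sampled_diff f s y xs)) <=
     2 * L1 * (favg f y - favg f xs - dotp (grad (favg f) xs) (y - xs))) ->
  (eta <= 1 / (6 * L1) ->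
     forall k, {ae P, forall t,
       (E_ k (fun t' => sqnorm (x k.+1 t' - xs) + D k.+1 t')%R t <=
        ((1 - eta * mu / (1 + eta * mu_psi)) * sqnorm (x k t - xs))%:E
        + (1 - p / 2)%:E * E_ k (D k) t)%E}) /\
  (eta = 1 / (6 * L1) ->
     forall (eps : R) (k : nat), 0 < eps < 1 ->
       c * (1 / p + L1 / mu) * ln (1 / eps) <= k%:R ->
       ('E_P[Psi k] <= eps%:E * 'E_P[Psi 0%N])%E).
Proof.
exists 6 => // d n f psi S xs x0 eta p L_f mu_f mu_psi L1 disp T P.
move=> draw coin copy.
move=> mu x w D E_ Psi _ df pp pc _ xsmin _ unb rnd eta0 p01 _ mu_f0 mu_psi0.
move=> mu0 _ cf cpsi L10 smooth.
have draw_law := let: And4 dl _ _ _ := rnd in dl 0%N.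
have q_ge0 := has_law_ge0 draw_law.
have q_sum := has_law_sum1 draw_law.
have law_ge0 k := has_law_ge0 (history_has_law rnd (k:=k)).
pose it k := @iterates R d n f psi S x0 eta k.
have itE k t : lsvrg f psi eta x0 (draw^~ t) (coin^~ t) k =
    it k (history draw coin k t) by exact: lsvrg_iterates.
pose hc k t := (history draw coin k t, copy t).
pose Df k (u : hist_type S k * outcome S) :=
  Dquant f eta p mu_psi xs u.2 (it k u.1).2.
pose Pf k (u : hist_type S k * outcome S) :=
  sqnorm ((it k u.1).1 - xs) + Df k u.
have DE k : D k = fun t => Df k (hc k t).
  by apply/funext => t; rewrite /D /w itE.
have PsiE k : Psi k = fun t => Pf k (hc k t).
  by apply/funext => t; rewrite /Psi DE /x itE.
have hcl k : has_law P (hc k) _ := history_copy_has_law rnd (k:=k).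
split=> [eta_le k|etaE eps k /andP[eps0 eps1] kge]; last first.
  have EPsi j : ('E_P[Psi j] = (lyapunov f psi S xs x0 eta p mu_psi j)%:E)%E.
    rewrite PsiE (expectation_has_law (hcl j)); congr EFin.
    transitivity (\sum_(u : hist_type S j * outcome S)
        (hist_law p u.1 * sampling_law u.2) * (Pf j u * (fun=> 1) u.1)).
      by apply: eq_bigr => u _; rewrite mulr1.
    rewrite (@history_copy_sum _ _ _ p j (Pf j) (fun=> 1)).
    apply: eq_bigr => h _; congr (_ * _).
    rewrite mul1r.
    exact: (sample_mean_cstD (sqnorm ((it j h).1 - xs))
      (fun c => Df j (h, c)) q_sum).
  clearbody Psi; rewrite !EPsi -EFinM lee_fin.
  have [A0 A1 r2 r1] := lsvrg_rate_le p01 L10 mu_f0 mu_psi0 mu0.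
  rewrite -etaE -/mu in r1.
  have eta_le : eta <= 1 / (6 * L1) by rewrite etaE.
  apply: (le_trans (lyapunov_rate _ q_sum q_ge0 law_ge0 df unb eta0 p01 mu_psi0
    pp pc cf cpsi xsmin L10 smooth eta_le _ _ r1 r2)).
    by rewrite subr_ge0.
  apply: ler_wpM2r; first exact: lyapunov_ge0.
  exact: contraction_iterations.
(* Outside a null set the realized history has positive probability, so the
   conditioning event is not null. *)
have := ae_has_law_neq0 (history_has_law rnd (k:=k)).
apply: filterS => t pi_neq0.
pose h0 := history draw coin k t.
pose o (h : hist_type S k) : R := (it k h == it k h0)%:R.
have ZE : (fun t => (x k t, w k t)) = fun t => it k (history draw coin k t).
  by apply/funext => u; rewrite /x /w itE; case: (it k _).
have E1 : E_ k (fun t' => sqnorm (x k.+1 t' - xs) + D k.+1 t')%R t =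
  ((fine (P [set u | it k (history draw coin k u) = it k h0]))^-1 *
   \sum_(u : hist_type S k.+1 * outcome S)
    (hist_law p u.1 * sampling_law u.2) * (Pf k.+1 u * o u.1.1.1))%:E.
  rewrite /E_ ZE (_ : (fun t' => _) = fun t' => Pf k.+1 (hc k.+1 t')).
    exact: (cond_expectation_has_law (fun u => it k u.1.1.1) _ t (hcl k.+1)).
  exact: PsiE.
have E2 : E_ k (D k) t =
  ((fine (P [set u | it k (history draw coin k u) = it k h0]))^-1 *
   \sum_(u : hist_type S k * outcome S)
    (hist_law p u.1 * sampling_law u.2) * (Df k u * o u.1))%:E.
  rewrite /E_ ZE DE.
  exact: (cond_expectation_has_law (fun u => it k u.1) _ t (hcl k)).
have PA : P [set u | it k (history draw coin k u) = it k h0] =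
    (\sum_h hist_law p h * o h)%:E.
  rewrite -(probability_has_law (history_has_law rnd (k:=k))
    (fun h => it k h == it k h0)); congr (P _).
  by apply/seteqP; split=> u /= /eqP.
rewrite E1 E2 PA /= -EFinM -EFinD lee_fin.
have a0 : 0 < \sum_h hist_law p h * o h.
  rewrite (bigD1 h0) //= /o eqxx mulr1 ltr_pwDl //.
    by rewrite lt_def pi_neq0 law_ge0.
  by apply: sumr_ge0 => h _; rewrite mulr_ge0.
set a := \sum_h _ in a0 *.
have o_ge0 h : 0 <= o h by [].
have step := weighted_step x0 q_sum q_ge0 law_ge0 df unb eta0 p01 mu_psi0
  pp pc cf cpsi xsmin L10 smooth eta_le o_ge0.
have xtE : x k t = (it k h0).1 by rewrite /x itE.
rewrite (@history_copy_sum _ _ _ p k (Df k) o) ler_pdivrMl // xtE.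
apply: (le_trans step).
have split_sum (al be sq : R) (m : hist_type S k -> R) :
    a * (al * sq + be * (a^-1 * \sum_h hist_law p h * (o h * m h))) =
    \sum_h hist_law p h * (o h * (al * sq + be * m h)).
  rewrite mulrDr mulrCA [a * (be * _)]mulrCA mulVKf ?gt_eqF //.
  rewrite /a mulr_suml !mulr_sumr -big_split /=.
  by apply: eq_bigr => h _; ring.
(* The weight o selects the histories that lead to the same iterate as h0. *)
rewrite split_sum; apply: ler_sum => h _.
rewrite /o; have [hh0|_] := eqVneq (it k h) (it k h0); last by rewrite !mul0r.
by rewrite -hh0.
Qed.
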